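(* For every $U,V,Z\in\mathbb{BC}$, $$\sum_{m,n=0}^{\infty}H_{m,n}(Z,Z^* )\frac{U^mV^n}{m!\,n!}=e^{UZ+VZ^*-UV}.$$
   Context: Bicomplex numbers: $\mathbb{BC}$ is the commutative real algebra generated by two commuting imaginary units $\mathbf{i},\mathbf{j}$ ($\mathbf{i}^2=\mathbf{j}^2=-1$), with $\mathbf{k}=\mathbf{i}\mathbf{j}$, $\mathbf{k}^2=1$; it is a 4-dimensional real vector space with its usual topology. Put $\mathbf{e}_1=\frac{1+\mathbf{k}}{2}$, $\mathbf{e}_2=\frac{1-\mathbf{k}}{2}$ (idempotents with $\mathbf{e}_1\mathbf{e}_2=0$, $\mathbf{e}_1+\mathbf{e}_2=1$). Each $Z=z_1+\mathbf{j}z_2$ with $z_1,z_2\in\mathbb{C}=\mathbb{C}(\mathbf{i})$ is uniquely $Z=\lambda_1\mathbf{e}_1+\lambda_2\mathbf{e}_2$ with $\lambda_1=z_1-\mathbf{i}z_2$, $\lambda_2=z_1+\mathbf{i}z_2\in\mathbb{C}$. The $*$-conjugate is $Z^*=\overline{z_1}-\mathbf{j}\overline{z_2}=\overline{\lambda_1}\mathbf{e}_1+\overline{\lambda_2}\mathbf{e}_2$. The bicomplex exponential is $e^{Z}=e^{\lambda_1}\mathbf{e}_1+e^{\lambda_2}\mathbf{e}_2$ (equivalently, its power series). The $Z^*$-bicomplex Hermite polynomials of the first kind are, for integers $m,n\ge0$, $$H_{m,n}(Z,Z^* )=\sum_{k=0}^{\min(m,n)}(-1)^k k!\binom{m}{k}\binom{n}{k}Z^{m-k}(Z^*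 )^{n-k}.$$ *)

(* Defs.v *)
From HB Require Import structures.
From mathcomp Require Import all_boot all_order all_algebra finmap complex ring.
From mathcomp Require Import all_classical all_reals all_analysis.
From mathcomp Require summability.

Set Implicit Arguments.
Unset Strict Implicit.
Unset Printing Implicit Defensive.

Import Order.TTheory GRing.Theory Num.Theory.
Import numFieldNormedType.Exports.
Import ComplexField.Normc.

Local Open Scope ring_scope.
Local Open Scope complex_scope.

(* Bicomplex z1 z2 is z1 + j z2, with z1, z2 in C(i). *)
Record bicomplex (R : realType) := Bicomplex { bc_z1 : R[i]; bc_z2 : R[i] }.

Section BicomplexAlgebra.
Variable R : realType.
Local Notation BC := (bicomplex R).
Implicit Types Z W : BC.

Definition pair_of_bc Z : R[i] * R[i] := (bc_z1 Z, bc_z2 Z).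
Definition bc_of_pair (z : R[i] * R[i]) : BC := Bicomplex z.1 z.2.

Lemma pair_of_bcK : cancel pair_of_bc bc_of_pair.
Proof. by case. Qed.

HB.instance Definition _ := Choice.copy BC (can_type pair_of_bcK).

Lemma bc_eqP Z W : bc_z1 Z = bc_z1 W -> bc_z2 Z = bc_z2 W -> Z = W.
Proof. by case: Z W => [? ?] [? ?] /= -> ->. Qed.

Definition bc_zero : BC := Bicomplex 0 0.
Definition bc_opp Z : BC := Bicomplex (- bc_z1 Z) (- bc_z2 Z).
Definition bc_add Z W : BC :=
  Bicomplex (bc_z1 Z + bc_z1 W) (bc_z2 Z + bc_z2 W).

Let bc_addA : associative bc_add.
Proof. by move=> Z W X; apply: bc_eqP => /=; ring. Qed.

Let bc_addC : commutative bc_add.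
Proof. by move=> Z W; apply: bc_eqP => /=; ring. Qed.

Let bc_add0 : left_id bc_zero bc_add.
Proof. by move=> Z; apply: bc_eqP => /=; ring. Qed.

Let bc_addN : left_inverse bc_zero bc_opp bc_add.
Proof. by move=> Z; apply: bc_eqP => /=; ring. Qed.

HB.instance Definition _ :=
  GRing.isZmodule.Build BC bc_addA bc_addC bc_add0 bc_addN.

Definition bc_one : BC := Bicomplex 1 0.
Definition bc_mul Z W : BC :=
  Bicomplex (bc_z1 Z * bc_z1 W - bc_z2 Z * bc_z2 W)
            (bc_z1 Z * bc_z2 W + bc_z2 Z * bc_z1 W).

Let bc_mulA : associative bc_mul.
Proof. by move=> Z W X; apply: bc_eqP => /=; ring. Qed.

Let bc_mulC : commutative bc_mul.
Proof. by move=> Z W; apply: bc_eqP => /=; ring. Qed.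

Let bc_mul1 : left_id bc_one bc_mul.
Proof. by move=> Z; apply: bc_eqP => /=; ring. Qed.

Let bc_mulDl : left_distributive bc_mul bc_add.
Proof. by move=> Z W X; apply: bc_eqP => /=; ring. Qed.

Let bc_one_neq0 : bc_one != bc_zero.
Proof. by apply/eqP => -[] /eqP; rewrite oner_eq0. Qed.

HB.instance Definition _ :=
  GRing.Zmodule_isComNzRing.Build BC
    bc_mulA bc_mulC bc_mul1 bc_mulDl bc_one_neq0.

Definition bc_scale (a : R) Z : BC :=
  Bicomplex (a%:C * bc_z1 Z) (a%:C * bc_z2 Z).

Let bc_scaleA a b Z : bc_scale a (bc_scale b Z) = bc_scale (a * b) Z.
Proof. by apply: bc_eqP; rewrite /= rmorphM mulrA. Qed.

Let bc_scale1 : left_id 1 bc_scale.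
Proof. by move=> Z; apply: bc_eqP; rewrite /= rmorph1 mul1r. Qed.

Let bc_scaleDr : right_distributive bc_scale +%R.
Proof. by move=> a Z W; apply: bc_eqP => /=; ring. Qed.

Let bc_scaleDl Z : {morph bc_scale^~ Z : a b / a + b}.
Proof. by move=> a b; apply: bc_eqP; rewrite /= rmorphD mulrDl. Qed.

HB.instance Definition _ :=
  GRing.Zmodule_isLmodule.Build R BC
    bc_scaleA bc_scale1 bc_scaleDr bc_scaleDl.

Let bc_scaleAl (a : R) Z W : a *: (Z * W) = a *: Z * W.
Proof. by apply: bc_eqP => /=; ring. Qed.

HB.instance Definition _ := GRing.Lmodule_isLalgebra.Build R BC bc_scaleAl.
HB.instance Definition _ := GRing.Lalgebra_isComAlgebra.Build R BC.

(* The Euclidean norm of R^4. *)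
Definition bc_norm Z : R :=
  Num.sqrt (normc (bc_z1 Z) ^+ 2 + normc (bc_z2 Z) ^+ 2).

Let normc_ge0 (z : R[i]) : 0 <= normc z.
Proof. by case: z => x y; exact: sqrtr_ge0. Qed.

Let bc_normD Z W : bc_norm (Z + W) <= bc_norm Z + bc_norm W.
Proof.
have bc_normE (X : BC) :
    bc_norm X = normc (normc (bc_z1 X) +i* normc (bc_z2 X)).
  by [].
rewrite !bc_normE; apply: le_trans (le_normcD _ _); rewrite /= ler_wsqrtr//.
have le_sqr (z w : R[i]) : normc (z + w) ^+ 2 <= (normc z + normc w) ^+ 2.
  by rewrite lerXn2r ?nnegrE ?addr_ge0 ?normc_ge0// le_normcD.
exact: lerD (le_sqr _ _) (le_sqr _ _).
Qed.

Let bc_normZ (a : R) Z : bc_norm (a *: Z) = `|a| * bc_norm Z.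
Proof.
have normca : normc a%:C ^+ 2 = a ^+ 2 :> R.
  by rewrite /= expr0n addr0 sqr_sqrtr ?sqr_ge0.
rewrite /bc_norm /= !normcM !exprMn normca -mulrDr.
by rewrite sqrtrM ?sqr_ge0// sqrtr_sqr.
Qed.

Let bc_norm0_eq0 Z : bc_norm Z = 0 -> Z = 0.
Proof.
move/eqP; rewrite sqrtr_eq0 => Z_le0.
have := Z_le0; rewrite le_eqVlt ltNge addr_ge0 ?sqr_ge0//= orbF.
rewrite paddr_eq0 ?sqr_ge0// !sqrf_eq0 => /andP[/eqP z1_0 /eqP z2_0].
by apply: bc_eqP; exact: eq0_normc.
Qed.

HB.instance Definition _ :=
  Lmodule_isNormed.Build R BC bc_normD bc_normZ bc_norm0_eq0.

End BicomplexAlgebra.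

Section BicomplexFunctions.
Variable R : realType.
Local Notation BC := (bicomplex R).
Implicit Types Z : BC.

(* The inclusion of C(i) in BC. *)
Definition bc_of_complex (z : R[i]) : BC := Bicomplex z 0.
Local Notation "z %:BC" := (bc_of_complex z) (at level 2, format "z %:BC").

Definition bc_i : BC := ('i%C)%:BC.
Definition bc_j : BC := Bicomplex 0 1.
Definition bc_k : BC := bc_i * bc_j.

Definition bc_e1 : BC := 2^-1 *: (1 + bc_k).
Definition bc_e2 : BC := 2^-1 *: (1 - bc_k).

Definition bc_lambda1 Z : R[i] := bc_z1 Z - 'i%C * bc_z2 Z.
Definition bc_lambda2 Z : R[i] := bc_z1 Z + 'i%C * bc_z2 Z.

Definition bc_star Z : BC := ((bc_z1 Z)^*%C)%:BC - bc_j * ((bc_z2 Z)^*%C)%:BC.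

Definition expC (z : R[i]) : R[i] :=
  (expR (complex.Re z) * cos (complex.Im z)) +i* (expR (complex.Re z) * sin (complex.Im z)).

Definition bc_exp Z : BC :=
  (expC (bc_lambda1 Z))%:BC * bc_e1 + (expC (bc_lambda2 Z))%:BC * bc_e2.

(* H_{m,n}(Z, Z* ): the second variable is always the conjugate of Z. *)
Definition bc_hermite (m n : nat) Z : BC :=
  \sum_(k < (minn m n).+1)
     (-1) ^+ k * (k`! * 'C(m, k) * 'C(n, k))%:R
       * Z ^+ (m - k) * bc_star Z ^+ (n - k).

Let sqr_i : 'i%C * 'i%C = -1 :> R[i].
Proof. by simpc. Qed.

Lemma bc_i_sqr : bc_i * bc_i = -1.
Proof. by apply: bc_eqP => /=; rewrite ?sqr_i; ring. Qed.

Lemma bc_j_sqr : bc_j * bc_j = -1.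
Proof. by apply: bc_eqP => /=; ring. Qed.

Lemma bc_cartesian Z : Z = (bc_z1 Z)%:BC + bc_j * (bc_z2 Z)%:BC.
Proof. by apply: bc_eqP => /=; ring. Qed.

Let half : (2^-1 : R)%:C = 2^-1.
Proof. by rewrite fmorphV rmorph_nat. Qed.

Lemma bc_idempotent Z :
  Z = (bc_lambda1 Z)%:BC * bc_e1 + (bc_lambda2 Z)%:BC * bc_e2.
Proof.
apply: bc_eqP; rewrite /= /bc_lambda1 /bc_lambda2 half; first by field.
by field: sqr_i.
Qed.

Lemma bc_e1_e2 : bc_e1 * bc_e2 = 0.
Proof.
by apply: bc_eqP; rewrite /= half; field: sqr_i.
Qed.

Lemma bc_star_idempotent Z :
  bc_star Z =
    ((bc_lambda1 Z)^*%C)%:BC * bc_e1 + ((bc_lambda2 Z)^*%C)%:BC * bc_e2.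
Proof.
have conj_i : ('i%C)^*%C = - 'i%C :> R[i] by simpc.
have conjM (z w : R[i]) : (z * w)^*%C = z^*%C * w^*%C by exact: rmorphM.
have conjD (z w : R[i]) : (z + w)^*%C = z^*%C + w^*%C by exact: rmorphD.
have conjB (z w : R[i]) : (z - w)^*%C = z^*%C - w^*%C by exact: rmorphB.
have conj1 : (bc_lambda1 Z)^*%C = (bc_z1 Z)^*%C + 'i%C * (bc_z2 Z)^*%C.
  by rewrite /bc_lambda1 conjB conjM conj_i mulNr opprK.
have conj2 : (bc_lambda2 Z)^*%C = (bc_z1 Z)^*%C - 'i%C * (bc_z2 Z)^*%C.
  by rewrite /bc_lambda2 conjD conjM conj_i mulNr.
apply: bc_eqP; rewrite /= conj1 conj2 half; first by field.
by field: sqr_i.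
Qed.

End BicomplexFunctions.

(* Unconditional convergence of a family: the net of sums over finite index
   sets, directed by inclusion, tends to s. *)
Definition has_sum (I : choiceType) (K : numDomainType) (E : normedModType K)
    (x : I -> E) (s : E) : Prop :=
  (summability.partial_sum x @ summability.totally --> s)%classic.

(* Main.v *)
From HB Require Import structures.
Require Import Defs.
From mathcomp Require Import all_boot all_order all_algebra complex.
From mathcomp Require Import all_classical all_reals all_analysis.
From mathcomp Require Import finmap ring zify lra.
From mathcomp Require summability.

Set Implicit Arguments.
Unset Strict Implicit.
Unset Printing Implicit Defensive.

Import Order.TTheory GRing.Theory Num.Theory.
Import numFieldNormedType.Exports.
Import ComplexField.Normc.

Local Open Scope ring_scope.

(** The (m,n) term of the series is a finite sum: with A = U Z, B = V Z^*,
    C = - U V it collects the monomials A^a B^b C^k / (a! b! k!) with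
    (a + k, b + k) = (m, n), each triple (a,b,k) occurring for exactly one
    (m,n) (lemma [hermite_gf_termE]).  Summed over all triples, these monomials
    give e^A e^B e^C.  Absolute convergence is what allows the regrouping, and
    it is used in a quantitative form.

    The two idempotent coordinates lambda1 and lambda2 are ring morphisms to
    the complex numbers which carry the bicomplex exponential to the complex
    one, and they control the norm ([bc_norm_le]); so the whole estimate takes
    place in the complex numbers.

    If F is a finite set of indices containing the square [0,2N)^2, the triples
    regrouped by F contain the cube [0,N)^3.  The sum over F therefore differs
    from E_N(A) E_N(B) E_N(C), where E_N is the N-th partial sum of exp, by a
    tail of the same series with the moduli replaced by real majorants
    alpha, beta, gamma.  That product differs from e^A e^B e^C by a similar
    tail ([majorizedM], [expC_majorized]).  Both tails are at most
    e^(alpha + beta + gamma) - E_N(alpha) E_N(beta) E_N(gamma), which tends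
    to 0; this is [hermite_estimate].

    The complex exponential is given as e^x (cos y + i sin y), so its power
    series has to be derived: the series of expR, cos and sin give it on the
    two axes, and a Cauchy product, with the same tail bound, combines them. *)

(** * Partial sums of the exponential series and their products *)

Definition exp_term (K : numFieldType) (z : K) (n : nat) : K :=
  z ^+ n / n`!%:R.

Definition exp_sum (K : numFieldType) (z : K) (N : nat) : K :=
  \sum_(n < N) exp_term z n.

Definition nat_triple M (t : 'I_M * 'I_M * 'I_M) : nat * nat * nat :=
  (t.1.1 : nat, t.1.2 : nat, t.2 : nat).

Section Algebra.
Variable K : numFieldType.
Implicit Types a b c : K.

Lemma fact_neq0 n : n`!%:R != 0 :> K.
Proof. by rewrite pnatr_eq0 -lt0n fact_gt0. Qed.

Lemma exp_termD a b n :
  exp_term (a + b) n = \sum_(k < n.+1) exp_term a (n - k) * exp_term b k.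
Proof.
rewrite /exp_term exprDn mulr_suml; apply: eq_bigr => -[k /=]; rewrite ltnS => kn _.
rewrite -mulr_natr -(bin_fact kn) !natrM.
by field; rewrite !fact_neq0 pnatr_eq0 -lt0n bin_gt0 kn.
Qed.

Lemma exp_sum_widen a N M : (N <= M)%N ->
  exp_sum a N = \sum_(i < M | (i < N)%N) exp_term a i.
Proof. by move=> NM; rewrite /exp_sum (big_ord_widen _ (exp_term a) NM). Qed.

Definition exp_term3 a b c (t : nat * nat * nat) : K :=
  exp_term a t.1.1 * exp_term b t.1.2 * exp_term c t.2.

Lemma exp_sum_prod3 a b c N M : (N <= M)%N ->
  exp_sum a N * exp_sum b N * exp_sum c N =
  \sum_(t : 'I_M * 'I_M * 'I_M | [&& t.1.1 < N, t.1.2 < N & t.2 < N]%N)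
     exp_term3 a b c (nat_triple t).
Proof.
move=> NM; rewrite !(exp_sum_widen _ NM) big_distrlr pair_big big_distrlr /= pair_big /=.
by apply: eq_bigl => t; rewrite andbA.
Qed.

Lemma exp_sum_prod a b N :
  exp_sum a N * exp_sum b N =
  \sum_(p : 'I_N * 'I_N) exp_term a p.1 * exp_term b p.2.
Proof. by rewrite /exp_sum big_distrlr pair_big. Qed.

(** Binomial theorem: the partial sum at a + b is the triangular part of the
    square that expands the product of the partial sums. *)
Lemma exp_sumD a b N :
  exp_sum (a + b) N =
  \sum_(p : 'I_N * 'I_N | (p.1 + p.2 < N)%N) exp_term a p.1 * exp_term b p.2.
Proof.
case: N => [|N]; first by rewrite /exp_sum !(big_ord0, big1) // => -[[]].
rewrite (partition_big (fun p : 'I_N.+1 * 'I_N.+1 => inord (p.1 + p.2) : 'I_N.+1) xpredT) //=.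
apply: eq_bigr => n _; rewrite exp_termD.
rewrite (big_ord_widen N.+1 (fun k => exp_term a (n - k) * exp_term b k)) //.
rewrite (reindex_onto (fun p : 'I_N.+1 * 'I_N.+1 => p.2)
  (fun k : 'I_N.+1 => (inord (n - k), k))) //=.
have E (p : 'I_N.+1 * 'I_N.+1) : (p.2 < n.+1)%N && ((inord (n - p.2), p.2) == p) =
   ((p.1 + p.2 < N.+1)%N && (inord (p.1 + p.2) == n)).
  case: p => [p q] /=; rewrite xpair_eqE eqxx andbT -!val_eqE /=.
  have := ltn_ord n; have := ltn_ord p; have := ltn_ord q => ltq ltp ltn.
  rewrite inordK; last by lia.
  case: (ltnP (p + q) N.+1) => pq; last by lia.
  by rewrite inordK //; lia.
rewrite (eq_bigl _ _ E); apply: eq_bigr => -[p q] /= /andP[pq].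
by rewrite -val_eqE /= inordK // => /eqP <-; rewrite addnK.
Qed.

End Algebra.

(** * Regrouping the triple product series by Hermite index *)

Lemma partial_sumE (I : choiceType) (E : zmodType) (x : I -> E) (F : {fset I}) :
  summability.partial_sum x F = \sum_(i <- F) x i.
Proof. by rewrite big_seq_fsetE. Qed.

Section Regrouping.
Variable K : numFieldType.
Implicit Types u v z w : K.

Definition hermite_index (t : nat * nat * nat) : nat * nat :=
  (t.1.1 + t.2, t.1.2 + t.2)%N.

(** General term of the generating function of the Hermite polynomials
    H_{m,n}(z, w) in two variables; with w the conjugate of z it is an
    idempotent coordinate of the bicomplex term. *)
Definition hermite_gf_term u v z w (p : nat * nat) : K :=
  (p.1`!%:R * p.2`!%:R)^-1 *
    ((\sum_(k < (minn p.1 p.2).+1) (-1) ^+ k * (k`! * 'C(p.1, k) * 'C(p.2, k))%:R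
        * z ^+ (p.1 - k) * w ^+ (p.2 - k)) * u ^+ p.1 * v ^+ p.2).

(** Each k-th summand splits into three exponential terms, because
    k! C(m,k) C(n,k) / (m! n!) = 1 / (k! (m-k)! (n-k)!) and
    u^m v^n = u^(m-k) v^(n-k) (u v)^k. *)
Lemma hermite_gf_termE u v z w m n :
  hermite_gf_term u v z w (m, n) =
  \sum_(k < (minn m n).+1)
    exp_term3 (u * z) (v * w) (- (u * v)) (m - k, n - k, k : nat)%N.
Proof.
rewrite /hermite_gf_term /= !mulr_suml mulr_sumr; apply: eq_bigr => -[k /=].
rewrite ltnS leq_min => /andP[km kn] _.
rewrite /exp_term3 /exp_term /=.
rewrite -{1}(bin_fact km) -{1}(bin_fact kn) !natrM -[- (u * v)]mulN1r !exprMn.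
have -> : u ^+ m = u ^+ (m - k) * u ^+ k by rewrite -exprD subnK.
have -> : v ^+ n = v ^+ (n - k) * v ^+ k by rewrite -exprD subnK.
by field; rewrite !fact_neq0 !pnatr_eq0 -!lt0n !bin_gt0 km kn.
Qed.

(** The range of k in the Hermite sum parametrizes the fiber of [hermite_index]
    over (m,n).  Any cube that contains m and n in its side contains the whole
    fiber. *)
Lemma fiber_sum (f : nat * nat * nat -> K) M m n :
  (m < M)%N -> (n < M)%N ->
  \sum_(k < (minn m n).+1) f (m - k, n - k, k : nat)%N =
  \sum_(t : 'I_M * 'I_M * 'I_M |
        hermite_index (nat_triple t) == (m, n))
     f (nat_triple t).
Proof.
case: M => // M mM nM.
rewrite (@big_ord_widen _ _ _ _ M.+1 (fun k => f (m - k, n - k, k)%N)); last first.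
  by rewrite ltnS geq_min; lia.
rewrite (reindex_onto (fun t : 'I_M.+1 * 'I_M.+1 * 'I_M.+1 => t.2)
  (fun k : 'I_M.+1 => (inord (m - k), inord (n - k), k))) //=.
have E (t : 'I_M.+1 * 'I_M.+1 * 'I_M.+1) :
    (t.2 < (minn m n).+1)%N && ((inord (m - t.2), inord (n - t.2), t.2) == t) =
    (hermite_index (nat_triple t) == (m, n)).
  case: t => [[a b] k] /=; rewrite /hermite_index !xpair_eqE /= eqxx andbT.
  rewrite -!val_eqE /= !inordK; [|lia..].
  by apply/idP/idP; lia.
rewrite (eq_bigl _ _ E); apply: eq_bigr => -[[a b] k] /=.
by rewrite /hermite_index xpair_eqE /= => /andP[/eqP <- /eqP <-]; rewrite !addnK.
Qed.

(** The fibers of [hermite_index] being disjoint, a partial sum of the double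
    family is a partial sum of the triple product series. *)
Lemma partial_sum_hermite u v z w (F : {fset nat * nat}) M :
  (forall p, p \in F -> p.1 < M /\ p.2 < M)%N ->
  summability.partial_sum (hermite_gf_term u v z w) F =
  \sum_(t : 'I_M * 'I_M * 'I_M |
        hermite_index (nat_triple t) \in F)
     exp_term3 (u * z) (v * w) (- (u * v)) (nat_triple t).
Proof.
move=> FM; rewrite partial_sumE /=.
pose f := exp_term3 (u * z) (v * w) (- (u * v)).
transitivity (\sum_(p <- F)
    \sum_(t : 'I_M * 'I_M * 'I_M | hermite_index (nat_triple t) == p)
      f (nat_triple t)).
  apply: eq_big_seq => -[m n] pF; rewrite hermite_gf_termE.
  by have [mM nM] := FM _ pF; exact: (fiber_sum f).
rewrite big_seq.
rewrite (exchange_big_dep (fun t => hermite_index (nat_triple t) \in F)) /=.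
  apply: eq_bigr => t tF; rewrite -big_seq_cond -big_filter.
  (* t lies over exactly one element of F *)
  rewrite (_ : seq.filter _ _ = [:: hermite_index (nat_triple t)]) ?big_seq1 //.
  rewrite -(filter_pred1_uniq (fset_uniq F) tF).
  by apply: eq_filter => p; rewrite /= eq_sym.
by move=> p t pF /eqP ->.
Qed.

End Regrouping.

(** * Tails of exponential series *)

Section RealExp.
Variable R : realType.
Implicit Types (s t x y : R).

Lemma exp_sum_series t : exp_sum t = series (exp_coeff t).
Proof. by apply/funext => N; rewrite /exp_sum /series /= big_mkord. Qed.

Lemma exp_sum_cvg t : (exp_sum t @ \oo --> expR t)%classic.
Proof. by rewrite exp_sum_series; exact: is_cvg_series_exp_coeff. Qed.

Lemma exp_term_ge0 t n : 0 <= t -> 0 <= exp_term t n.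
Proof. by move=> t0; rewrite /exp_term divr_ge0 ?exprn_ge0. Qed.

Lemma exp_sum_ge0 t N : 0 <= t -> 0 <= exp_sum t N.
Proof. by move=> t0; apply: sumr_ge0 => n _; exact: exp_term_ge0. Qed.

Lemma exp_sum_le_expR t N : 0 <= t -> exp_sum t N <= expR t.
Proof.
move=> t0; rewrite -(cvg_lim _ (@exp_sum_cvg t)) //.
apply: nondecreasing_cvgn_le; last by apply: cvgP; exact: exp_sum_cvg.
apply/nondecreasing_seqP => n; rewrite /exp_sum big_ord_recr /=.
by rewrite lerDl exp_term_ge0.
Qed.

End RealExp.

Section ComplexMajorants.
Variable R : realType.
Local Notation C := R[i].
Implicit Types (a b c w z : C) (s t x y : R).

Lemma normc_ge0 z : 0 <= normc z.
Proof. by case: z => x y; exact: sqrtr_ge0. Qed.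

Lemma normc_real x : normc x%:C%C = `|x|.
Proof. by rewrite /= expr0n addr0 sqrtr_sqr. Qed.

(** The majorant of choice for the complex exponential: unlike the modulus, it
    turns the factorization of expC z along the two axes into
    expR (l1norm z) = expR |x| * expR |y|. *)
Definition l1norm z : R := `|complex.Re z| + `|complex.Im z|.

Lemma normc_le_l1norm z : normc z <= l1norm z.
Proof.
rewrite /l1norm; case: z => x y /=; rewrite -[leRHS]ger0_norm ?addr_ge0// -sqrtr_sqr.
by rewrite ler_wsqrtr // -(real_normK (num_real x)) -(real_normK (num_real y));
   have := normr_ge0 x; have := normr_ge0 y; nra.
Qed.

Lemma normc_sum (I : Type) (r : seq I) (P : pred I) (F : I -> C) :
  normc (\sum_(i <- r | P i) F i) <= \sum_(i <- r | P i) normc (F i).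
Proof.
elim/big_rec2: _ => [|i y x _ IH]; first by rewrite normc0.
by apply: le_trans (le_normcD _ _) _; rewrite lerD2l.
Qed.

Lemma normcX z n : normc (z ^+ n) = normc z ^+ n.
Proof. by elim: n => [|n IH]; rewrite ?normc1 // !exprS normcM IH. Qed.

Lemma exp_term_majorant a t n : normc a <= t -> normc (exp_term a n) <= exp_term t n.
Proof.
move=> at_; rewrite /exp_term normcM normcV normcX.
rewrite -(rmorph_nat (real_complex R)) normc_real ger0_norm ?ler0n //.
have t0 : 0 <= t by exact: le_trans (normc_ge0 _) at_.
by rewrite ler_wpM2r ?invr_ge0 ?ler0n // lerXn2r ?nnegrE ?normc_ge0.
Qed.

Lemma exp_sum_majorant a t N : normc a <= t -> normc (exp_sum a N) <= exp_sum t N.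
Proof.
move=> at_; apply: le_trans (normc_sum _ _ _) _.
by apply: ler_sum => n _; exact: exp_term_majorant.
Qed.

(** The missing terms are controlled by the majorants, and no majorant is
    negative; so the difference of the majorant sums can be taken over all
    indices, whatever Q is. *)
Lemma normc_sum_sub (I : finType) (P Q : pred I) (F : I -> C) (G : I -> R) :
  (forall i, P i -> Q i) -> (forall i, normc (F i) <= G i) ->
  normc (\sum_(i | Q i) F i - \sum_(i | P i) F i) <=
  \sum_i G i - \sum_(i | P i) G i.
Proof.
move=> PQ FG.
have G0 i : 0 <= G i by exact: le_trans (normc_ge0 _) (FG i).
rewrite (bigID P) /= (eq_bigl P); last first.
  by move=> i; case: (boolP (P i)) => [/PQ ->|]; rewrite ?andbF.
rewrite addrAC subrr add0r (bigID P xpredT) /= addrAC subrr add0r.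
apply: le_trans (normc_sum _ _ _) _.
rewrite big_mkcond [leRHS]big_mkcond /=; apply: ler_sum => i _.
by move: (FG i) (G0 i); case: (Q i); case: (P i).
Qed.

End ComplexMajorants.

Section ComplexExp.
Variable R : realType.
Local Notation C := R[i].
Implicit Types (a b c w z : C) (s t x y : R).

(** w and s are to be thought of as limits, w' and s' as their approximations
    by partial sums: the complex partial sum is bounded by the real one, and so
    is the complex tail. *)
Definition majorized w w' s s' := normc w' <= s' /\ normc (w - w') <= s - s'.

(** Both products telescope in the same way,
    w z - w' z' = w (z - z') + (w - w') z', and the bounds match term by term. *)
Lemma majorizedM w w' s s' z z' t t' :
  majorized w w' s s' -> majorized z z' t t' ->
  majorized (w * z) (w' * z') (s * t) (s' * t').
Proof.
move=> [ws' ws] [zt' zt]; split; first by rewrite normcM ler_pM ?normc_ge0.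
have wn : normc w <= s.
  by rewrite -[w](subrK w'); apply: le_trans (le_normcD _ _) _; lra.
have -> : w * z - w' * z' = w * (z - z') + (w - w') * z' by ring.
apply: le_trans (le_normcD _ _) _; rewrite !normcM.
have -> : s * t - s' * t' = s * (t - t') + (s - s') * t' by ring.
by apply: lerD; apply: ler_pM; rewrite ?normc_ge0.
Qed.

Lemma cvg_dist0 (u : nat -> R) (l : R) :
  (u @ \oo --> l -> (fun n => `|l - u n|) @ \oo --> (0 : R))%classic.
Proof.
move=> ul; rewrite -(normr0 R) -(subrr l).
by apply: cvg_norm; apply: cvgB ul; exact: cvg_cst.
Qed.

(** If the exponential series at a has sum w, its tails are bounded by those of
    the real series at t: this is so for tails cut at some M, and M is
    arbitrarily large. *)
Lemma majorized_limit a t w N :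
  normc a <= t ->
  ((fun M => normc (w - exp_sum a M)) @ \oo --> (0 : R))%classic ->
  majorized w (exp_sum a N) (expR t) (exp_sum t N).
Proof.
move=> at_ cw; split; first exact: exp_sum_majorant.
have t0 : 0 <= t by exact: le_trans (normc_ge0 _) at_.
apply/ler_addgt0Pl => e e0.
have /cvgrPdist_lt/(_ e e0)[M0 _ cwM] := cw.
pose M := maxn M0 N.
have := cwM M (leq_maxl _ _); rewrite /= sub0r normrN ger0_norm ?normc_ge0 // => wM.
rewrite -(subrK (exp_sum a M) w) -addrA.
apply: le_trans (le_normcD _ _) _; apply: lerD (ltW wM) _.
have NM : (N <= M)%N by exact: leq_maxr.
apply: (@le_trans _ _ (exp_sum t M - exp_sum t N)); last first.
  by rewrite lerD2r exp_sum_le_expR.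
rewrite !(exp_sum_widen _ NM) /exp_sum.
by apply: (normc_sum_sub (Q := xpredT)) => // n; exact: exp_term_majorant.
Qed.

(** The Cauchy product defect is a sum over the pairs (p, q) of a square with
    p + q >= N, where moduli may be replaced by majorants. *)
Lemma normc_exp_sumD a b s t N : normc a <= s -> normc b <= t ->
  normc (exp_sum a N * exp_sum b N - exp_sum (a + b) N) <=
  exp_sum s N * exp_sum t N - exp_sum (s + t) N.
Proof.
move=> as_ bt; rewrite !exp_sum_prod !exp_sumD.
apply: (normc_sum_sub (Q := xpredT)) => // -[p q] /=.
by rewrite normcM ler_pM ?normc_ge0 ?exp_term_majorant.
Qed.

Lemma exp_sum_real x N : exp_sum x%:C%C N = (exp_sum x N)%:C%C :> C.
Proof.
rewrite /exp_sum rmorph_sum /=; apply: eq_bigr => n _.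
by rewrite /exp_term rmorphM fmorphV rmorphXn rmorph_nat.
Qed.

Lemma exp_term_imag y n :
  exp_term ('i%C * y%:C%C : C) n = (cos_coeff y n +i* sin_coeff y n)%C.
Proof.
rewrite /exp_term /cos_coeff /sin_coeff /= exprMn -rmorphXn /=.
rewrite -(rmorph_nat (real_complex R)) -fmorphV /=.
have -> : ('i%C : C) ^+ n =
    ((~~ odd n)%:R * (-1) ^+ n./2 +i* ((odd n)%:R * (-1) ^+ n.-1./2))%C.
  rewrite -[in LHS](odd_double_half n) exprD -mul2n exprM sqr_i.
  rewrite -(rmorphN1 (real_complex R)) -rmorphXn /=.
  (* same half if n is odd, one less if n is even, and truncation at n = 0 *)
  have -> : n.-1./2 = (n./2 - ~~ odd n)%N by lia.
  by apply/eqP; rewrite eq_complex; case: (odd n); rewrite /= ?expr0 ?expr1 ?subn0 /=;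
     apply/andP; split; apply/eqP; ring.
by apply/eqP; rewrite eq_complex /= -?exprnP; apply/andP; split; apply/eqP; ring.
Qed.

Lemma exp_sum_imag y N :
  exp_sum ('i%C * y%:C%C : C) N =
  (series (cos_coeff y) N +i* series (sin_coeff y) N)%C.
Proof.
rewrite /exp_sum /series /= !big_mkord.
elim: N => [|N IH]; first by rewrite !big_ord0.
by rewrite !big_ord_recr /= IH exp_term_imag.
Qed.

Lemma expC_real x : expC x%:C%C = (expR x)%:C%C.
Proof. by rewrite /expC /= cos0 sin0 mulr1 mulr0. Qed.

Lemma expC_imag y : expC ('i%C * y%:C%C) = (cos y +i* sin y)%C.
Proof. by rewrite (_ : 'i%C * y%:C%C = (0 +i* y)%C) /expC /= ?expR0 ?mul1r //; simpc. Qed.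

Lemma expCD z w : expC (z + w) = expC z * expC w.
Proof.
case: z => a b; case: w => c d; rewrite /expC /= expRD cosD sinD.
by apply/eqP; rewrite eq_complex /=; apply/andP; split; apply/eqP; ring.
Qed.

(** With z = x + i y, expC z = expC x * expC (i y) is approximated by
    E_N(x) E_N(i y) up to e^|x| e^|y| - E_N(|x|) E_N(|y|), and this product by
    E_N(z) up to E_N(|x|) E_N(|y|) - E_N(|x| + |y|); the two errors add up to
    the tail of the real exponential at |x| + |y|. *)
Lemma expC_majorized z N :
  majorized (expC z) (exp_sum z N) (expR (l1norm z)) (exp_sum (l1norm z) N).
Proof.
split; first by rewrite exp_sum_majorant ?normc_le_l1norm.
pose x := complex.Re z; pose y := complex.Im z.
have zE : z = x%:C%C + 'i%C * y%:C%C by exact: complexE.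
have nx : normc x%:C%C <= `|x| by rewrite normc_real.
have ny : normc ('i%C * y%:C%C) <= `|y|.
  by rewrite normcM normc_real /= expr0n expr1n add0r sqrtr1 mul1r.
have mx := @majorized_limit x%:C%C `|x| (expC x%:C%C) N nx _.
have my := @majorized_limit ('i%C * y%:C%C) `|y| (expC ('i%C * y%:C%C)) N ny _.
have [//||_ xy] := majorizedM (mx _) (my _).
- rewrite expC_real; under eq_fun => M do rewrite exp_sum_real -rmorphB normc_real.
  exact/cvg_dist0/exp_sum_cvg.
- rewrite expC_imag.
  apply: (@squeeze_cvgr _ _ _ _ (fun=> 0)
    (fun M => `|cos y - series (cos_coeff y) M| + `|sin y - series (sin_coeff y) M|)).
  + near=> M; rewrite normc_ge0 /= exp_sum_imag.
    exact: (normc_le_l1norm (_ +i* _)%C).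
  + exact: cvg_cst.
  + rewrite -[0]addr0; apply: cvgD; apply: cvg_dist0.
    * by rewrite unlock; exact: is_cvg_series_cos_coeff.
    * by rewrite unlock; exact: is_cvg_series_sin_coeff.
rewrite {1 2}zE expCD.
have := normc_exp_sumD N nx ny.
rewrite /l1norm expRD -/x -/y => D.
rewrite -(subrK (exp_sum x%:C%C N * exp_sum ('i%C * y%:C%C) N) (_ * _)) -addrA.
apply: le_trans (le_normcD _ _) _.
lra.
Unshelve. all: by end_near.
Qed.

End ComplexExp.

(** * The estimate over finite index sets *)

Lemma ler_pM3 (R : numDomainType) (x1 x2 x3 y1 y2 y3 : R) :
  0 <= x1 -> 0 <= x2 -> 0 <= x3 -> x1 <= y1 -> x2 <= y2 -> x3 <= y3 ->
  x1 * x2 * x3 <= y1 * y2 * y3.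
Proof. by move=> *; do 2?apply: ler_pM; rewrite ?mulr_ge0. Qed.

Section Estimate.
Variable R : realType.
Local Notation C := R[i].
Implicit Types (u v w z : C) (s t x y : R).

Definition exp_tail3 (r s t : R) N : R :=
  expR r * expR s * expR t - exp_sum r N * exp_sum s N * exp_sum t N.

Lemma exp_tail3_cvg0 r s t : (exp_tail3 r s t @ \oo --> (0 : R))%classic.
Proof.
rewrite /exp_tail3 -[X in (_ --> X)%classic](subrr (expR r * expR s * expR t)).
apply: cvgB; first exact: cvg_cst.
by apply: cvgM; [apply: cvgM|]; exact: exp_sum_cvg.
Qed.

Lemma fset_bound N (F : {fset nat * nat}) :
  exists2 M, (N <= M)%N & (forall p, p \in F -> p.1 < M /\ p.2 < M)%N.
Proof.
exists (N + (\max_(p <- F) (p.1 + p.2)).+1)%N; first exact: leq_addr.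
move=> p pF.
have := @leq_bigmax_seq _ _ xpredT (fun p : nat * nat => p.1 + p.2)%N _ pF isT.
by move: (\max_(p <- F) _)%N => m /= pm; lia.
Qed.

(** The side 2N makes the square large enough: indices a, b, k < N give
    (a + k, b + k) in [0,2N)^2, so F collects every triple of the cube [0,N)^3.
    One tail bounds the triples of F outside this cube, another one the distance
    from the cube sum to the exponential; hence the factor 2. *)
Lemma hermite_estimate u v z w N (F : {fset nat * nat}) :
  (forall m n, m < N.*2 -> n < N.*2 -> (m, n) \in F)%N ->
  normc (summability.partial_sum (hermite_gf_term u v z w) F -
         expC (u * z + v * w - u * v)) <=
  2 * exp_tail3 (l1norm (u * z)) (l1norm (v * w)) (l1norm (- (u * v))) N.
Proof.
move=> NF; have [M NM FM] := fset_bound N F.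
set a := u * z; set b := v * w; set c := - (u * v).
have [_ tailM] := majorizedM (majorizedM (expC_majorized a N) (expC_majorized b N))
  (expC_majorized c N).
rewrite (partial_sum_hermite _ _ _ _ FM) !expCD -/a -/b -/c.
have G3 (t : nat * nat * nat) :
    normc (exp_term3 a b c t) <= exp_term3 (l1norm a) (l1norm b) (l1norm c) t.
  rewrite /exp_term3 2!normcM.
  by apply: ler_pM3; rewrite ?normc_ge0 ?exp_term_majorant ?normc_le_l1norm.
have : normc (\sum_(t : 'I_M * 'I_M * 'I_M | hermite_index (nat_triple t) \in F)
     exp_term3 a b c (nat_triple t) - exp_sum a N * exp_sum b N * exp_sum c N) <=
   exp_sum (l1norm a) M * exp_sum (l1norm b) M * exp_sum (l1norm c) M -
   exp_sum (l1norm a) N * exp_sum (l1norm b) N * exp_sum (l1norm c) N.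
  rewrite !(exp_sum_prod3 _ _ _ NM) (exp_sum_prod3 _ _ _ (leqnn M)).
  rewrite [X in _ <= X - _](eq_bigl xpredT); last by move=> t; rewrite !ltn_ord.
  apply: normc_sum_sub => // t /and3P[t1 t2 t3].
  by apply: NF => /=; lia.
set S := bigop _ _ _; set E3 := exp_sum a N * _ * _ => SE.
have l1norm_ge0 (d : C) : 0 <= l1norm d by rewrite addr_ge0.
have EM : exp_sum (l1norm a) M * exp_sum (l1norm b) M * exp_sum (l1norm c) M <=
    expR (l1norm a) * expR (l1norm b) * expR (l1norm c).
  by apply: ler_pM3; rewrite ?exp_sum_ge0 ?exp_sum_le_expR.
(* E3, the sum over the cube, is the midpoint of both comparisons *)
have -> : S - expC a * expC b * expC c =
    (S - E3) + - (expC a * expC b * expC c - E3) by ring.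
apply: le_trans (le_normcD _ _) _; rewrite normcN mulr2n mulrDl !mul1r.
apply: lerD tailM; apply: le_trans SE _.
by rewrite lerD2r.
Qed.

End Estimate.

(** Turns an explicit error bound over the finite sets containing a given square
    into convergence along the net of all finite sets. *)
Lemma has_sum_by_squares (R : realType) (E : normedModType R)
    (x : nat * nat -> E) (s : E) (side : nat -> nat) (r : nat -> R) :
  (forall N (F : {fset nat * nat}),
     (forall m n, m < side N -> n < side N -> (m, n) \in F)%N ->
     `|summability.partial_sum x F - s| <= r N) ->
  (r @ \oo --> 0)%classic -> has_sum x s.
Proof.
move=> xr r0; have tF := @summability.totally_filter (nat * nat)%type.
apply/cvgrPdist_lt => e e0.
have /cvgrPdist_lt/(_ e e0)[N _ /(_ N (leqnn N))] := r0.
rewrite /= sub0r normrN => /(le_lt_trans (ler_norm _)) rN.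
exists [fset p in
  [seq (m, n) | m <- iota 0 (side N), n <- iota 0 (side N)]]%fset => //.
move=> F /= /fsubsetP squareF; rewrite distrC (le_lt_trans (xr N F _)) //.
move=> m n mN nN; apply: squareF; rewrite in_fset; apply/allpairsP.
by exists (m, n); rewrite !mem_iota.
Qed.

(** * Idempotent coordinates of bicomplex numbers *)

Section Components.
Variable R : realType.
Local Notation C := R[i].
Local Notation BC := (bicomplex R).

Lemma lambda1_zmod : zmod_morphism (@bc_lambda1 R).
Proof. by move=> Z W; rewrite /bc_lambda1 /=; ring. Qed.

Lemma lambda1_monoid : monoid_morphism (@bc_lambda1 R).
Proof.
split=> [|Z W]; rewrite /bc_lambda1 /=; first by ring.
by ring: (sqr_i R).
Qed.

HB.instance Definition _ := GRing.isZmodMorphism.Build BC C (@bc_lambda1 R) lambda1_zmod.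
HB.instance Definition _ := GRing.isMonoidMorphism.Build BC C (@bc_lambda1 R) lambda1_monoid.

Lemma lambda2_zmod : zmod_morphism (@bc_lambda2 R).
Proof. by move=> Z W; rewrite /bc_lambda2 /=; ring. Qed.

Lemma lambda2_monoid : monoid_morphism (@bc_lambda2 R).
Proof.
split=> [|Z W]; rewrite /bc_lambda2 /=; first by ring.
by ring: (sqr_i R).
Qed.

HB.instance Definition _ := GRing.isZmodMorphism.Build BC C (@bc_lambda2 R) lambda2_zmod.
HB.instance Definition _ := GRing.isMonoidMorphism.Build BC C (@bc_lambda2 R) lambda2_monoid.

Lemma lambda1_exp (W : BC) : bc_lambda1 (bc_exp W) = expC (bc_lambda1 W).
Proof.
rewrite /bc_exp; set x := expC _; set y := expC _.
rewrite /bc_lambda1 /= fmorphV rmorph_nat.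
by field: (sqr_i R).
Qed.

Lemma lambda2_exp (W : BC) : bc_lambda2 (bc_exp W) = expC (bc_lambda2 W).
Proof.
rewrite /bc_exp; set x := expC _; set y := expC _.
rewrite /bc_lambda2 /= fmorphV rmorph_nat.
by field: (sqr_i R).
Qed.

Lemma lambda1Z (a : R) (W : BC) : bc_lambda1 (a *: W) = a%:C%C * bc_lambda1 W.
Proof. by rewrite /bc_lambda1 /=; ring. Qed.

Lemma lambda2Z (a : R) (W : BC) : bc_lambda2 (a *: W) = a%:C%C * bc_lambda2 W.
Proof. by rewrite /bc_lambda2 /=; ring. Qed.

(** The cartesian coordinates are (lambda1 + lambda2) / 2 and
    i (lambda1 - lambda2) / 2, each at most half the right-hand side. *)
Lemma bc_norm_le (W : BC) : `|W| <= normc (bc_lambda1 W) + normc (bc_lambda2 W).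
Proof.
rewrite /Num.norm /= /bc_norm.
have -> : bc_z1 W = 2^-1 * (bc_lambda1 W + bc_lambda2 W).
  by rewrite /bc_lambda1 /bc_lambda2; field.
have -> : bc_z2 W = (2^-1 * 'i%C) * (bc_lambda1 W - bc_lambda2 W).
  by rewrite /bc_lambda1 /bc_lambda2; field: (sqr_i R).
set p := bc_lambda1 W; set q := bc_lambda2 W.
have n2 : normc (2^-1 : C) = 2^-1.
  by rewrite normcV -(rmorph_nat (real_complex R)) normc_real ger0_norm.
have ni : normc ('i%C : C) = 1 by rewrite /= expr0n expr1n add0r sqrtr1.
rewrite !normcM n2 ni mulr1.
have := le_normcD p q; have := le_normcD p (- q); rewrite normcN.
have := normc_ge0 p; have := normc_ge0 q.
have := normc_ge0 (p + q); have := normc_ge0 (p - q).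
move: (normc (p + q)) (normc (p - q)) (normc p) (normc q) => x y s t y0 x0 t0 s0 xst yst.
rewrite -[leRHS]ger0_norm ?addr_ge0// -sqrtr_sqr ler_wsqrtr //.
nra.
Qed.

Lemma hermite_morph (f : {rmorphism BC -> C})
   (fZ : forall (a : R) (W : BC), f (a *: W) = a%:C%C * f W) (U V Z : BC) F :
 f (summability.partial_sum (fun mn : nat * nat =>
       ((mn.1`!%:R * mn.2`!%:R)^-1 : R) *:
         (bc_hermite mn.1 mn.2 Z * U ^+ mn.1 * V ^+ mn.2)) F) =
 summability.partial_sum (hermite_gf_term (f U) (f V) (f Z) (f (bc_star Z))) F.
Proof.
rewrite !partial_sumE rmorph_sum; apply: eq_bigr => -[m n] _ /=.
rewrite fZ fmorphV !rmorphM !rmorph_nat /= /hermite_gf_term /= !rmorphXn.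
congr (_ * (_ * _ * _)); rewrite rmorph_sum; apply: eq_bigr => k _.
by rewrite 3!rmorphM !rmorphXn rmorphN1 rmorph_nat.
Qed.

End Components.

(** * The generating function *)

Theorem theorem5p8 (R : realType) (U V Z : bicomplex R) :
  has_sum
    (fun mn : nat * nat =>
       ((mn.1`!%:R * mn.2`!%:R)^-1 : R) *:
         (bc_hermite mn.1 mn.2 Z * U ^+ mn.1 * V ^+ mn.2))
    (bc_exp (U * Z + V * bc_star Z - U * V)).
Proof.
set x := fun mn : nat * nat => _; set W := _ + _ - _.
pose T (f : bicomplex R -> R[i]) :=
  exp_tail3 (l1norm (f U * f Z)) (l1norm (f V * f (bc_star Z))) (l1norm (- (f U * f V))).
apply: (has_sum_by_squares (side := double)
  (r := fun N => 2 * T (@bc_lambda1 R) N + 2 * T (@bc_lambda2 R) N)); last first.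
  rewrite -[X in (_ --> X)%classic]addr0 -{1}(mulr0 2) -{2}(mulr0 2).
  by apply: cvgD; apply: cvgMr; exact: exp_tail3_cvg0.
move=> N F squareF; apply: le_trans (bc_norm_le _) _.
rewrite !rmorphB /= lambda1_exp lambda2_exp !rmorphB !rmorphD !rmorphM /=.
apply: lerD; rewrite hermite_morph; [|exact: lambda1Z| |exact: lambda2Z].
  exact: hermite_estimate.
exact: hermite_estimate.
Qed.
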